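(* For every constant $C>0$ there is a constant $c>0$ (depending only on $C$) such that the following holds. Let $n\geq 1$ and $\ell\geq 3$ be integers with $\ell\leq C\sqrt{n}$, and let $P$ be a set of $n$ points in the plane $\mathbb{R}^2$ with at most $\ell$ collinear. Then $P$ contains a subset of at least $c\sqrt{\frac{n}{\ln \ell}}$ points in general position.
   Context: A set of points in the plane has ''at most $\ell$ collinear'' if every line contains at most $\ell$ points of the set. A set of points in the plane is in general position if it contains no three collinear points. The asymptotic hypothesis $\ell\leq O(\sqrt n)$ and conclusion $\Omega(\sqrt{n/\ln\ell})$ are written out here with explicit constants. *)

(* Defs.v *)
From mathcomp Require Import all_boot all_order all_algebra.
From mathcomp Require Import finmap.
From mathcomp Require Import reals.

Set Implicit Arguments.
Unset Strict Implicit.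
Unset Printing Implicit Defensive.

Import Order.TTheory GRing.Theory Num.Theory.
Local Open Scope ring_scope.

Section PlaneGeometry.
Variable R : realType.

(* The points (x, y) with a x + b y = d; a line only when (a, b) != (0, 0). *)
Definition line (a b d : R) : {pred R * R} :=
  [pred p : R * R | a * p.1 + b * p.2 == d].

Definition collinear3 (p q r : R * R) : Prop :=
  exists a b d : R,
    (a, b) != (0, 0) /\ [/\ p \in line a b d, q \in line a b d & r \in line a b d].

Definition at_most_collinear (l : nat) (P : {fset R * R}) : Prop :=
  forall a b d : R, (a, b) != (0, 0) ->
    (#|` [fset p in P | p \in line a b d]%fset | <= l)%N.

(* The three points are required to be pairwise distinct, as any two points lie
   on a common line. *)
Definition general_position (P : {fset R * R}) : Prop :=
  forall p q r : R * R, p \in P -> q \in P -> r \in P ->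
    p != q -> q != r -> p != r -> ~ collinear3 p q r.

End PlaneGeometry.

(* Main.v *)
(* By the Szemeredi-Trotter bound, at most O(n^2 / k^3) lines contain at least
   k = O(sqrt n) of the n points, so dyadic summation bounds the sum of |L|^3
   over all lines L, hence the number of collinear triples, by O(n^2 ln l).  A
   random sample of density about 1 / sqrt (n ln l), with one point deleted from
   each surviving collinear triple, is then in general position and has the
   required size.

   The Szemeredi-Trotter bound comes from Szekely's argument.  Joining
   consecutive points along the rich lines gives a straight-line drawing in which
   any two lines contribute at most one crossing; sampling turns the linear bound
   e <= 3 v for crossing-free straight-line drawings into a lower bound on the
   number of crossings.  The linear bound is proved by an injection in the
   spirit of the vertical decomposition, with no appeal to Euler's formula.  A
   shear makes all x-coordinates distinct beforehand, so that every relevant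
   line is a graph over the x-axis. *)

Require Import Defs.
From mathcomp Require Import all_boot all_order all_algebra.
From mathcomp Require Import finmap.
From mathcomp Require Import boolp reals exp.
From mathcomp Require Import zify ring lra.

Set Implicit Arguments.
Unset Strict Implicit.
Unset Printing Implicit Defensive.

Import Order.TTheory GRing.Theory Num.Theory.
Local Open Scope ring_scope.

(** * Straight-line drawings *)

Section Drawings.
Variables (R : realFieldType) (V : finType).
Implicit Types (X Y : V -> R) (e f g : V * V) (S : {set V}) (E : {set V * V}).

Definition slope X Y e : R := (Y e.2 - Y e.1) / (X e.2 - X e.1).

Definition height X Y e (x : R) : R := Y e.1 + slope X Y e * (x - X e.1).

Lemma height_left X Y e : height X Y e (X e.1) = Y e.1.
Proof. by rewrite /height subrr mulr0 addr0. Qed.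

Lemma height_right X Y e : X e.1 != X e.2 -> height X Y e (X e.2) = Y e.2.
Proof.
move=> neX; rewrite /height /slope divfK ?subr_eq0 1?eq_sym //; ring.
Qed.

Lemma heightN X Y e x : height X (fun v => - Y v) e x = - height X Y e x.
Proof. by rewrite /height /slope -opprD mulNr mulNr opprD. Qed.

Lemma eq_height X Y e f x y z : x != y ->
  height X Y e x = height X Y f x -> height X Y e y = height X Y f y ->
  height X Y e z = height X Y f z.
Proof.
rewrite /height => nexy ex ey.
have nz : x - y != 0 by rewrite subr_eq0.
have es : slope X Y e = slope X Y f by apply: (mulIf nz); lra.
rewrite es in ex *; lra.
Qed.

Lemma height_meet X Y e f x z : x < z ->
    height X Y f x < height X Y e x -> height X Y e z < height X Y f z ->
  exists2 t, x < t < z & height X Y e t = height X Y f t.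
Proof.
move=> ltxz hx hz.
set p := height X Y e x - height X Y f x.
set q := height X Y f z - height X Y e z.
have p0 : 0 < p by rewrite subr_gt0.
have q0 : 0 < q by rewrite subr_gt0.
have pq0 : 0 < p + q by apply: addr_gt0.
(* The difference of the heights is affine, equal to [p] at [x] and to [- q] at [z], so it vanishes
   at the fraction [p / (p + q)] of the interval. *)
exists (x + (z - x) * (p / (p + q))).
  have r0 : 0 < p / (p + q) by rewrite divr_gt0.
  have r1 : p / (p + q) < 1 by rewrite ltr_pdivrMr // mul1r ltrDl.
  have zx : 0 < z - x by rewrite subr_gt0.
  rewrite ltrDl mulr_gt0 //=; have := ltr_pM2l zx (p / (p + q)) 1.
  by rewrite r1 mulr1 => h; rewrite -(subrK x z) addrC ltrD2r subrK h.
apply/eqP; rewrite -subr_eq0; apply/eqP.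
rewrite (_ : _ - _ = p - (p + q) * (p / (p + q))); last first.
  by rewrite /p /q /height; ring.
by rewrite mulrCA mulfV ?mulr1 ?subrr // gt_eqF.
Qed.

(** The common abscissa must be interior to both edges: meeting only at a shared endpoint is no
    crossing, overlapping along a segment is one. *)
Definition cross X Y e f : bool :=
  (e != f) && `[< exists x, [/\ X e.1 < x < X e.2, X f.1 < x < X f.2
                              & height X Y e x = height X Y f x] >].

(** Edges point to the right, so a pair of vertices carries at most one edge. The vertex set [S] is
    a parameter so that one can pass to random subsets. *)
Definition drawing X Y S E : Prop :=
  {in E, forall e, [/\ e.1 \in S, e.2 \in S, X e.1 < X e.2 &
    {in S, forall w, X e.1 < X w < X e.2 -> height X Y e (X w) != Y w}]}.

Definition noncrossing X Y E : Prop := {in E &, forall e f, ~~ cross X Y e f}.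

Lemma crossN X Y e f : cross X (fun v => - Y v) e f = cross X Y e f.
Proof.
rewrite /cross; congr (_ && _); apply/asbool_equiv_eq; split=> -[x [h1 h2 h3]];
  by exists x; split=> //; move: h3; rewrite !heightN;
  first [by move/oppr_inj | by move->].
Qed.

Lemma drawingN X Y S E : drawing X Y S E -> drawing X (fun v => - Y v) S E.
Proof.
move=> dE e /dE[h1 h2 h3 h4]; split=> // w wS wx.
by rewrite heightN eqr_opp h4.
Qed.

(** If two overlapping edges on one line had different endpoints, an endpoint of one would lie
    inside the other, which a drawing forbids. *)
Lemma drawing_overlap X Y S E e f x : injective X -> drawing X Y S E ->
    e \in E -> f \in E -> X e.1 < x < X e.2 -> X f.1 < x < X f.2 ->
    height X Y e =1 height X Y f -> e = f.
Proof.
move=> injX dE eE fE /andP[xe1 xe2] /andP[xf1 xf2] eqh.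
have [e1 e2 le he] := dE _ eE; have [f1 f2 lf hf] := dE _ fE.
rewrite [e]surjective_pairing [f]surjective_pairing; congr (_, _); apply: injX.
  apply: le_anti; rewrite !leNgt; apply/andP; split; apply/negP => lt.
    have /eqP[] : height X Y f (X e.1) != Y e.1.
      by apply: hf => //; rewrite lt (lt_trans xe1).
    by rewrite -eqh height_left.
  have /eqP[] : height X Y e (X f.1) != Y f.1.
    by apply: he => //; rewrite lt (lt_trans xf1).
  by rewrite eqh height_left.
apply: le_anti; rewrite !leNgt; apply/andP; split; apply/negP => lt.
  have /eqP[] : height X Y e (X f.2) != Y f.2.
    by apply: he => //; rewrite lt (lt_trans xe1).
  by rewrite eqh height_right ?lt_eqF.
have /eqP[] : height X Y f (X e.2) != Y e.2.
  by apply: hf => //; rewrite lt (lt_trans xf1).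
by rewrite -eqh height_right ?lt_eqF.
Qed.

(** A change of the vertical order between [x] and [z] would force a meeting point strictly between
    them, interior to both edges. *)
Lemma noncrossing_le X Y E e f x z : noncrossing X Y E -> e \in E -> f \in E ->
    z <= X e.2 -> z <= X f.2 -> height X Y e z < height X Y f z ->
    X e.1 <= x <= z -> X f.1 <= x -> height X Y e x <= height X Y f x.
Proof.
move=> nc eE fE ze zf hz /andP[ex xz] fx; rewrite leNgt; apply/negP => hx.
have xltz : x < z.
  rewrite lt_neqAle xz andbT; apply/eqP => exz; rewrite exz in hx.
  by have := lt_trans hx hz; rewrite ltxx.
have [t /andP[xt tz] ht] := height_meet xltz hx hz.
have := nc _ _ eE fE; rewrite negb_and => /orP[|/asboolP[]].
  by rewrite negbK => /eqP ef; rewrite ef ltxx in hz.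
by exists t; split=> //; apply/andP; split;
   rewrite ?(le_lt_trans _ xt) ?(lt_le_trans tz).
Qed.

(* [e] and [f] are consecutive edges leaving the same vertex to the right, and
   [w] is the leftmost vertex of the sector between them. *)
Definition wedge X Y S E e f w : Prop :=
  [/\ [/\ e \in E, f \in E, e.1 = f.1 & slope X Y e < slope X Y f],
      {in E, forall g, g.1 = e.1 ->
         ~~ (slope X Y e < slope X Y g < slope X Y f)},
      [/\ w \in S, X e.1 < X w, X w <= X e.2, X w <= X f.2 &
          height X Y e (X w) <= Y w <= height X Y f (X w)] &
      {in S, forall v, X e.1 < X v < X w ->
         ~~ (height X Y e (X v) <= Y v <= height X Y f (X v))}].

Lemma wedgeN X Y S E e f w :
  wedge X Y S E e f w -> wedge X (fun v => - Y v) S E f e w.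
Proof.
have sN g : slope X (fun v => - Y v) g = - slope X Y g.
  by rewrite /slope -opprD mulNr.
move=> [[eE fE ef lef] h2 [wS lw lwe lwf /andP[hw1 hw2]] h4]; split.
- by split; rewrite // !sN ltrN2.
- by move=> g gE gf; rewrite !sN !ltrN2 andbC h2 // gf.
- by split; rewrite -?ef // !heightN !lerN2 hw1 hw2.
- by move=> v vS; rewrite -ef !heightN !lerN2 => vx; rewrite andbC h4.
Qed.

(** Suppose [f'] is strictly above [f] over [w], and compare the apexes. If that of [f'] is further
    right, it is squeezed between [e'] and [f'] onto [f], inside that edge. If that of [f] is
    further right, it lies in the sector of [e'] and [f'] before [w]. If they coincide, [f]
    separates the consecutive edges [e'] and [f']. *)
Lemma wedge_upper_le X Y S E e f e' f' w :
  injective X -> drawing X Y S E -> noncrossing X Y E ->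
  wedge X Y S E e f w -> wedge X Y S E e' f' w ->
  Y w < height X Y f (X w) -> Y w < height X Y f' (X w) ->
  height X Y f' (X w) <= height X Y f (X w).
Proof.
move=> injX dE nc [[eE fE ef lef] _ [wS lw lwe lwf /andP[hwe _]] _].
move=> [[eE' fE' ef' lef'] nx' [_ lw' lwe' lwf' /andP[hwe' _]] mn'] ltf ltf'.
rewrite leNgt; apply/negP => lff'.
have [f1S f2S lf hf] := dE _ fE; have [f1S' f2S' lf' hf'] := dE _ fE'.
rewrite ef in lw; rewrite ef' in lw'.
have lwf2 : X w < X f.2.
  rewrite lt_neqAle lwf andbT; apply/eqP => /injX ewf.
  by move: ltf; rewrite ewf height_right ?ltxx // lt_eqF.
have le1 x : X f'.1 <= x <= X w -> X f.1 <= x ->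
    height X Y e' x <= height X Y f x.
  move=> h1 h2; apply: (noncrossing_le nc (z := X w)) => //.
  - exact: le_lt_trans ltf.
  - by rewrite ef'.
have le2 x : X f.1 <= x <= X w -> X f'.1 <= x ->
    height X Y f x <= height X Y f' x.
  by move=> h1 h2; apply: (noncrossing_le nc (z := X w)).
have hl' : height X Y e' (X f'.1) = Y f'.1 by rewrite -ef' height_left.
case: (ltgtP (X f.1) (X f'.1)) => [lt|gt|/injX eq].
- have /eqP[] : height X Y f (X f'.1) != Y f'.1.
    by apply: hf => //; rewrite lt (lt_trans lw').
  apply: le_anti; rewrite -{2}hl' le1 ?lexx ?(ltW lt) ?(ltW lw') // andbT.
  by rewrite -(height_left X Y f') le2 ?lexx ?(ltW lt) ?(ltW lw').
- have := mn' _ f1S; rewrite ef' gt lw => /(_ isT)/negP[].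
  by rewrite -(height_left X Y f) le1 ?le2 ?lexx ?(ltW gt) ?(ltW lw).
- have /negP[] := nx' _ fE (etrans eq (esym ef')).
  have pw : 0 < X w - X f.1 by rewrite subr_gt0.
  have := le_lt_trans hwe' ltf; move: lff'.
  rewrite /height ef' -eq !ltrD2l !(ltr_pM2r pw) => -> ->; exact: isT.
Qed.

(** By symmetry the two upper edges have the same height over [w]. As [w] is strictly below them,
    neither ends there, so distinct edges would cross. *)
Lemma wedge_inj X Y S E e f e' f' w :
  injective X -> drawing X Y S E -> noncrossing X Y E ->
  wedge X Y S E e f w -> wedge X Y S E e' f' w ->
  Y w < height X Y f (X w) -> Y w < height X Y f' (X w) -> f = f'.
Proof.
move=> injX dE nc we we' lt lt'.
have eqf : height X Y f (X w) = height X Y f' (X w).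
  by apply: le_anti; rewrite (wedge_upper_le injX dE nc we we')
                             ?(wedge_upper_le injX dE nc we' we).
case: we => [[eE fE ef _] _ [wS lw lwe lwf _] _].
case: we' => [[eE' fE' ef' _] _ [_ lw' lwe' lwf' _] _].
rewrite ef in lw; rewrite ef' in lw'.
have str g : X g.1 < X w -> X w <= X g.2 -> Y w < height X Y g (X w) ->
    X g.1 < X w < X g.2.
  move=> h1; rewrite h1 le_eqVlt => /orP[/eqP/injX ewg|//].
  by rewrite ewg height_right ?ltxx // -ewg lt_eqF.
have := nc _ _ fE fE'; rewrite negb_and negbK => /orP[/eqP//|/asboolP[]].
by exists (X w); split=> //; apply: str.
Qed.
End Drawings.

(** * Edge bounds for straight-line drawings *)

Section PlanarBound.
Variables (R : realFieldType) (V : finType) (X Y : V -> R).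
Hypothesis injX : injective X.
Implicit Types (e f g : V * V) (S : {set V}) (E : {set V * V}).

Lemma drawing_same_slope S E e f : drawing X Y S E -> e \in E -> f \in E ->
  e.1 = f.1 -> slope X Y e = slope X Y f -> e = f.
Proof.
move=> dE eE fE ef efs; have [_ _ le _] := dE _ eE; have [_ _ lf _] := dE _ fE.
have lm : X e.1 < Num.min (X e.2) (X f.2) by rewrite lt_min le ef lf.
have [x1] := midf_lt lm; rewrite lt_min => /andP[x2 x3].
apply: (drawing_overlap (x := (X e.1 + Num.min (X e.2) (X f.2)) / 2) injX dE).
- by [].
- by [].
- by rewrite x1.
- by rewrite -ef x1.
- by move=> x; rewrite /height ef efs.
Qed.

(** The upper edge is the next steeper one at the apex. Of the two right endpoints, the one further
    left lies in the sector, so a leftmost vertex exists. *)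
Lemma exists_wedge S E e g : drawing X Y S E -> e \in E -> g \in E ->
  g.1 = e.1 -> slope X Y e < slope X Y g -> exists p, wedge X Y S E e p.1 p.2.
Proof.
move=> dE eE gE ge leg.
pose P g := [&& g \in E, g.1 == e.1 & slope X Y e < slope X Y g].
have Pg : P g by rewrite /P gE ge eqxx.
case: (@Order.TotalTheory.arg_minP _ _ _ _ P (slope X Y) Pg) => f
  /and3P[fE /eqP fe lef] minf.
have [e1S e2S le he] := dE _ eE; have [f1S f2S lf hf] := dE _ fE.
have lt_neq (x y : R) : x < y -> x != y by move/lt_eqF->.
pose T w := [&& w \in S, X e.1 < X w, X w <= X e.2, X w <= X f.2 &
          (height X Y e (X w) <= Y w <= height X Y f (X w))].
have hef x : X e.1 <= x -> height X Y e x <= height X Y f x.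
  by move=> ex; rewrite /height fe lerD2l ler_wpM2r ?subr_ge0 // ltW.
have [w0 Tw0] : exists w, T w.
  have he2 := height_right Y (lt_neq _ _ le).
  have hf2 := height_right Y (lt_neq _ _ lf).
  have lef2 : X e.1 < X f.2 by rewrite -fe.
  case: (leP (X e.2) (X f.2)) => h; [exists e.2 | exists f.2]; apply/and5P;
    split; rewrite ?(ltW h) //.
    by rewrite he2 lexx -he2 hef // ltW.
  by rewrite hf2 lexx andbT -hf2 hef // ltW.
case: (@Order.TotalTheory.arg_minP _ _ _ _ T X Tw0) => w
  /and5P[wS lw lwe lwf hw] minw.
exists (f, w); split=> //=.
- move=> h hE he1; apply/negP => /andP[h1 h2].
  by have := minf h; rewrite /P hE he1 eqxx h1 leNgt h2 => /(_ isT).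
- move=> v vS /andP[lv lvw]; apply/negP => hv.
  have := minw v; rewrite /T vS lv hv (le_trans (ltW lvw) lwe).
  by rewrite (le_trans (ltW lvw) lwf) leNgt lvw => /(_ isT).
Qed.

(* Edges that are topmost among those leaving their left endpoint to the right
   are determined by that endpoint.  Any other edge starts a wedge, and by
   [wedge_inj], applied to the drawing or to its mirror image, it is determined
   by the closing vertex [w] together with the side on which [w] closes. *)
Lemma planar_bound S E :
  drawing X Y S E -> noncrossing X Y E -> (#|E| <= 3 * #|S|)%N.
Proof.
move=> dE nc.
pose N := [set e in E |
  [exists g in E, (g.1 == e.1) && (slope X Y e < slope X Y g)]].
have wN e : exists p, e \in N -> wedge X Y S E e p.1 p.2.
  case: (boolP (e \in N)) => [|_]; last by exists (e, e.1).
  rewrite inE => /andP[eE /existsP[g /and3P[gE /eqP ge lt]]].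
  by have [p wp] := exists_wedge dE eE gE ge lt; exists p.
have [F wF] := choice wN.
pose phi e := ((F e).2, Y (F e).2 < height X Y (F e).1 (X (F e).2)).
have lt_height e : e \in N ->
    height X Y e (X (F e).2) < height X Y (F e).1 (X (F e).2).
  move/wF=> [[eE fE ef lef] _ [_ lw _ _ _] _].
  by rewrite /height -ef ltrD2l ltr_pM2r // subr_gt0.
have injphi : {in N &, injective phi}.
  move=> e e' eN eN' [] ew.
  have we := wF _ eN; have we' := wF _ eN'; have le := lt_height _ eN.
  have le' := lt_height _ eN'; rewrite -ew in we' le' *.
  case: ltP => [lt /esym lt'|ge /esym/negbT ge'].
    have ff := wedge_inj injX dE nc we we' lt lt'.
    case: we => [[eE fE ef lef] nx _ _].
    case: we' => [[eE' fE' ef' lef'] nx' _ _].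
    have ee : e.1 = e'.1 by rewrite ef ef' ff.
    apply: (drawing_same_slope dE) => //; apply: le_anti; rewrite !leNgt.
    apply/andP; split; apply/negP => h.
      by have := nx' _ eE ee; rewrite h -ff lef.
    by have := nx _ eE' (esym ee); rewrite h ff lef'.
  (* Here [w] is not below the upper edges, hence strictly above both lower edges, which the
     reflection turns into upper ones. *)
  rewrite -leNgt in ge'.
  have nc' : noncrossing X (fun v => - Y v) E by move=> *; rewrite crossN nc.
  apply: (wedge_inj injX (drawingN dE) nc' (wedgeN we) (wedgeN we'));
    rewrite heightN ltrN2.
    exact: lt_le_trans ge.
  exact: lt_le_trans ge'.
have cN : (#|N| <= #|S| * 2)%N.
  rewrite -card_bool -cardsT -cardsX -(card_in_imset injphi).
  apply/subset_leq_card/subsetP => _ /imsetP[e eN ->].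
  by rewrite !inE andbT; case: (wF _ eN) => _ _ [].
have inj1 : {in E :\: N &, injective fst}.
  have nN e e' : e \in E :\: N -> e' \in E -> e.1 = e'.1 ->
      slope X Y e' <= slope X Y e.
    move=> /setDP[eE eN] eE' ee; rewrite leNgt; apply: contra eN => lt.
    by rewrite inE eE; apply/existsP; exists e'; rewrite eE' ee eqxx.
  move=> e e' eD eD' ee; move: (eD) (eD') => /setDP[eE _] /setDP[eE' _].
  by apply: (drawing_same_slope dE) => //; apply: le_anti; rewrite !nN.
have cD : (#|E :\: N| <= #|S|)%N.
  rewrite -(card_in_imset inj1).
  apply/subset_leq_card/subsetP => _ /imsetP[e /setDP[eE _] ->].
  by have [] := dE _ eE.
rewrite -(cardsID N E); have h := subset_leq_card (subsetIr E N).
by rewrite mulSn addnC leq_add // (leq_trans h) // mulnC.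
Qed.

(** Deleting one edge of a crossing pair lowers the number of edges by one and the number of ordered
    crossing pairs by at least one. *)
Lemma planar_bound_crossings S E : drawing X Y S E ->
  (#|E| <= 3 * #|S| + #|[set p in setX E E | cross X Y p.1 p.2]|)%N.
Proof.
have [k] := ubnP #|E|; elim: k E => // k IH E ltk dE.
case: (pselect (noncrossing X Y E)) => [nc|].
  by rewrite (leq_trans (planar_bound dE nc)) ?leq_addr.
move=> nc; have [e [f [eE fE cef]]] : exists e f,
    [/\ e \in E, f \in E & cross X Y e f].
  apply: contrapT => h; apply: nc => e f eE fE; apply/negP => c; apply: h.
  by exists e, f.
have cE := cardsD1 e E; rewrite eE in cE.
have dD : drawing X Y S (E :\ e) by move=> g /setD1P[_ /dE].
have := IH (E :\ e); rewrite cE in ltk => /(_ ltk dD).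
set A := [set p in setX (E :\ e) (E :\ e) | _]; set B := [set p in _ | _].
suff ltAB: (#|A| < #|B|)%N.
  by move=> h; rewrite cE add1n;
    rewrite (leq_trans (_ : _ <= (3 * #|S| + #|A|).+1)%N) // -addnS leq_add2l.
apply/proper_card/properP; split.
  apply/subsetP => p; rewrite !inE.
  by move=> /andP[/andP[/andP[_ ->] /andP[_ ->]] ->].
by exists (e, f); rewrite !inE ?eE ?fE ?cef ?eqxx.
Qed.

(** Crossing edges with a common endpoint would share two points, hence a line, and overlap. Four
    distinct endpoints yield the fourth power of the density in the sampling argument. *)
Lemma cross_card S E e f : drawing X Y S E -> e \in E -> f \in E ->
  cross X Y e f -> #|e.1 |: (e.2 |: (f.1 |: [set f.2]))| = 4%N.
Proof.
move=> dE eE fE /andP[nef /asboolP[x [xe xf ex]]].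
have [_ _ le he] := dE _ eE; have [_ _ lf hf] := dE _ fE.
have same y : x != y -> height X Y e y = height X Y f y -> False.
  move=> xy ey; move/eqP: nef; apply.
  apply: (drawing_overlap injX dE eE fE xe xf) => z; exact: eq_height xy ex ey.
move/andP: xe => [xe1 xe2]; move/andP: xf => [xf1 xf2].
have neq u v : X u < X v -> (u == v) = false.
  by move=> lt; apply/eqP => uv; rewrite uv ltxx in lt.
rewrite !cardsU1 cards1 !inE (neq _ _ le) (neq _ _ lf).
rewrite (neq _ _ (lt_trans xe1 xf2)).
rewrite [e.2 == f.1]eq_sym (neq _ _ (lt_trans xf1 xe2)).
have -> : (e.1 == f.1) = false.
  apply/eqP => ef; apply: (same (X e.1)); first by rewrite gt_eqF.
  by rewrite height_left ef height_left.
have -> // : (e.2 == f.2) = false.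
apply/eqP => ef; apply: (same (X e.2)); first by rewrite lt_eqF.
by rewrite height_right ?lt_eqF // ef height_right ?lt_eqF.
Qed.

End PlanarBound.

(** * Random colourings *)

Section Colourings.
Variable V : finType.
Implicit Types (A Q : {set V}).

(* A uniformly random colouring [c] makes [zeros c] a random set that contains
   each point independently with probability [1 / q.+1]. *)
Definition zeros q (c : {ffun V -> 'I_q.+1}) : {set V} := [set v | c v == ord0].

Lemma card_colourings A q :
  (#|[set c : {ffun V -> 'I_q.+1} | A \subset zeros c]| * q.+1 ^ #|A|
     = q.+1 ^ #|V|)%N.
Proof.
pose F v : {pred 'I_q.+1} := if v \in A then pred1 ord0 else predT.
have -> : #|[set c : {ffun V -> 'I_q.+1} | A \subset zeros c]| = #|family F|.
  apply: eq_card => c; rewrite !inE; apply/subsetP/familyP => [Ac v|Ac v vA].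
    by rewrite /F; case: ifP => // /Ac; rewrite inE.
  by have := Ac v; rewrite /F vA !inE.
rewrite card_family foldrE big_map big_enum /= (bigID (mem A)) /=.
rewrite big1 => [|v vA]; last by rewrite /F vA card1.
rewrite mul1n (eq_bigr (fun=> q.+1)) => [|v /negbTE vA]; last first.
  by rewrite /F vA card_ord.
by rewrite prod_nat_const -expnD addnC -(cardC A).
Qed.

(** Linearity of expectation, cleared of denominators: each support of size [k] survives with
    probability [q.+1 ^- k]. *)
Lemma sum_colourings (I : finType) (D : {set I}) (supp : I -> {set V}) k q :
    {in D, forall i, #|supp i| = k} ->
  ((\sum_(c : {ffun V -> 'I_q.+1}) #|[set i in D | supp i \subset zeros c]|)
     * q.+1 ^ k = #|D| * q.+1 ^ #|V|)%N.
Proof.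
move=> cD.
have cE (c : {ffun V -> 'I_q.+1}) : #|[set i in D | supp i \subset zeros c]|
    = (\sum_(i in D) (supp i \subset zeros c))%N.
  by rewrite -sum1dep_card big_mkcondr /=; apply: eq_bigr => i _; case: ifP.
rewrite (eq_bigr _ (fun c _ => cE c)) exchange_big big_distrl /= -sum_nat_const.
apply: eq_bigr => i iD; rewrite -(card_colourings (supp i) q) cD //.
congr (_ * _)%N; rewrite -sum1dep_card [RHS]big_mkcond /=.
by apply: eq_bigr => c _; case: ifP.
Qed.

Lemma sum_card_zeros q :
  ((\sum_(c : {ffun V -> 'I_q.+1}) #|zeros c|) * q.+1 = #|V| * q.+1 ^ #|V|)%N.
Proof.
have := @sum_colourings _ setT (fun v => [set v]) 1%N q (fun v _ => cards1 v).
rewrite cardsT expn1 => <-; congr (_ * _)%N; apply: eq_bigr => c _.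
by apply: eq_card => v; rewrite !inE sub1set inE.
Qed.

Definition triple (p : V * V * V) : {set V} := p.1.1 |: (p.1.2 |: [set p.2]).

(** Alteration method: removing one vertex of each surviving triple from [zeros c] leaves an
    independent set, no larger than a maximum one [Q]. Averaging over [c] and multiplying by
    [q.+1 ^ 3] gives the bound. *)
Lemma exists_independent (T : {set V * V * V}) q :
    {in T, forall p, #|triple p| = 3%N} ->
  exists Q, {in T, forall p, ~~ (triple p \subset Q)} /\
    (#|V| * q.+1 ^ 2 <= #|Q| * q.+1 ^ 3 + #|T|)%N.
Proof.
move=> cT; pose indep Q := [forall p in T, ~~ (triple p \subset Q)].
have i0 : indep set0.
  apply/forallP => p; apply/implyP => /cT c3.
  by apply/negP => /subset_leq_card; rewrite c3 cards0.
case: (@arg_maxnP _ _ indep (fun Q => #|Q|) i0) => Q /forallP iQ maxQ.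
exists Q; split=> [p pT|]; first by have := iQ p; rewrite pT.
have bound (c : {ffun V -> 'I_q.+1}) :
    (#|zeros c| <= #|Q| + #|[set p in T | triple p \subset zeros c]|)%N.
  set U := [set p in T | _]; pose W := zeros c :\: [set p.1.1 | p in U].
  have iW : indep W.
    apply/forallP => p; apply/implyP => pT; apply/negP => pW.
    have pU : p \in U by rewrite inE pT (subset_trans pW) ?subsetDl.
    have /(subsetP pW) : p.1.1 \in triple p by rewrite !inE eqxx.
    by rewrite inE (_ : _ \in _ = true) //; apply/imsetP; exists p.
  apply: (@leq_trans (#|W| + #|U|)); last by rewrite leq_add2r; apply: maxQ.
  rewrite /W -(cardsID [set p.1.1 | p in U] (zeros c)) addnC leq_add2l.
  apply: leq_trans (leq_imset_card (fun p => p.1.1) U).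
  by rewrite subset_leq_card ?subsetIr.
have := @leq_sum _ (index_enum _) xpredT _ _ (fun c _ => bound c).
rewrite big_split /= sum_nat_const card_ffun card_ord.
have := sum_card_zeros q; have := sum_colourings q cT.
move: (\sum_c _)%N (\sum_c _)%N => b a hb ha hab.
rewrite -(leq_pmul2r (_ : 0 < q.+1 ^ #|V|)%N) ?expn_gt0 //.
rewrite mulnDl -hb mulnAC -ha.
by rewrite -mulnA -expnS mulnAC -mulnDl [(#|Q| * _)%N]mulnC leq_mul2r hab orbT.
Qed.
End Colourings.

(** * Rich lines *)

Section RichLines.
Variables (R : realFieldType) (V : finType) (X Y : V -> R).
Hypothesis injX : injective X.
Implicit Types (e f g : V * V) (E : {set V * V}) (L : {set {set V}}).

(** In the drawing induced on a random vertex set, vertices, edges and crossings survive with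
    densities [q.+1] to the powers -1, -2 and -4. Average [planar_bound_crossings] and multiply by
    [q.+1 ^ 4]. *)
Lemma crossing_inequality E q : drawing X Y setT E ->
  (#|E| * q.+1 ^ 2
     <= 3 * #|V| * q.+1 ^ 3 + #|[set p in setX E E | cross X Y p.1 p.2]|)%N.
Proof.
move=> dE; set K := [set p in _ | _].
pose ends e := [set e.1; e.2]; pose ends2 (p : V * V * (V * V)) :=
  p.1.1 |: (p.1.2 |: (p.2.1 |: [set p.2.2])).
have bound (c : {ffun V -> 'I_q.+1}) :
    (#|[set e in E | ends e \subset zeros c]|
       <= 3 * #|zeros c| + #|[set p in K | ends2 p \subset zeros c]|)%N.
  set F := [set e in E | _].
  have dF : drawing X Y (zeros c) F.
    move=> e; rewrite inE subUset !sub1set => /andP[/dE[_ _ le he] /andP[e1 e2]].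
    by split=> // w _; apply: he.
  apply: leq_trans (planar_bound_crossings injX dF) _.
  rewrite leq_add2l; apply/subset_leq_card/subsetP => -[e f] /=.
  rewrite !inE /= => /andP[/andP[/andP[-> se] /andP[-> sf]] ->] /=.
  by rewrite /ends2 /= setUA subUset; apply/andP; split.
have c2 : {in E, forall e, #|ends e| = 2%N}.
  move=> e /dE[_ _ le _]; rewrite cards2.
  by case: eqP le => // ->; rewrite ltxx.
have c4 : {in K, forall p, #|ends2 p| = 4%N}.
  move=> [e f]; rewrite !inE /= => /andP[/andP[eE fE]].
  exact: (cross_card injX dE).
have := @leq_sum _ (index_enum _) xpredT _ _ (fun c _ => bound c).
rewrite big_split /= -big_distrr /=.
have := sum_card_zeros V q; have := sum_colourings q c2.
have := sum_colourings q c4.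
move: (\sum_c _)%N (\sum_c _)%N (\sum_c _)%N => z a k hk ha hz hab.
rewrite -(leq_pmul2r (_ : 0 < q.+1 ^ #|V|)%N) ?expn_gt0 //.
rewrite mulnAC -ha mulnDl -hk.
have -> : (3 * #|V| * q.+1 ^ 3 * q.+1 ^ #|V| = 3 * z * q.+1 ^ 4)%N.
  by rewrite mulnAC -(mulnA 3) -hz (expnS _ 3) !mulnA.
by rewrite -mulnA -expnD -mulnDl leq_mul2r hab orbT.
Qed.

Definition line_through e : {set V} := [set v | height X Y e (X v) == Y v].

Lemma line_left e : e.1 \in line_through e.
Proof. by rewrite inE height_left. Qed.

Lemma line_right e : e.1 != e.2 -> e.2 \in line_through e.
Proof. by move=> ne; rewrite inE height_right // (inj_eq injX). Qed.

Lemma height_line e f u v : u != v -> u \in line_through e ->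
  v \in line_through e -> u \in line_through f -> v \in line_through f ->
  height X Y e =1 height X Y f.
Proof.
rewrite !inE => ne /eqP ue /eqP ve /eqP uf /eqP vf z.
by apply: (@eq_height _ _ _ _ _ _ (X u) (X v)); rewrite ?inj_eq // ?ue ?ve.
Qed.

Lemma line_through2 e u v : u != v -> u \in line_through e ->
  v \in line_through e -> line_through (u, v) = line_through e.
Proof.
move=> ne ue ve; apply/setP => w; rewrite !inE (@height_line (u, v) e u v) //.
  exact: (line_left (u, v)).
exact: (@line_right (u, v)).
Qed.

(** A line is identified with its trace on the vertices, which has at least two elements and so
    determines it. *)
Definition lines : {set {set V}} :=
  [set line_through e | e in [set e | e.1 != e.2]].

Definition segments L : {set V * V} :=
  [set e | [&& X e.1 < X e.2, line_through e \in L &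
            [forall w in line_through e, ~~ (X e.1 < X w < X e.2)]]].

Lemma segments_drawing L : drawing X Y setT (segments L).
Proof.
move=> e; rewrite inE => /and3P[lt _ /forallP h]; split=> // w _ wx.
apply: contraTN wx => hw; have := h w; by rewrite inE hw.
Qed.

(** Every vertex of the line except the rightmost one, [m], starts the segment to its right
    neighbour. *)
Lemma card_line_segments l L : L \subset lines -> l \in L ->
  (#|l| <= #|[set e in segments L | line_through e == l]| + 1)%N.
Proof.
move=> sL lL; set F := [set e in _ | _].
have [e0 _ le] := imsetP (subsetP sL _ lL).
have u0 : e0.1 \in l by rewrite le line_left.
case: (@Order.TotalTheory.arg_maxP _ _ _ _ (mem l) X u0) => m ml maxm.
suff sub : l \subset m |: [set e.1 | e in F].
  apply: leq_trans (subset_leq_card sub) _; rewrite cardsU1 addnC leq_add //.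
    exact: leq_imset_card.
  by case: (_ \notin _).
apply/subsetP => u ul; rewrite !inE; case: eqP => //= /eqP num.
have ltum : X u < X m by rewrite lt_neqAle inj_eq // num; apply: maxm.
pose P v := (v \in l) && (X u < X v).
have Pm : P m by rewrite /P ltum andbT; apply: ml.
case: (@Order.TotalTheory.arg_minP _ _ _ _ P X Pm) => v /andP[vl ltuv] minv.
have luv : line_through (u, v) = l.
  have nuv : u != v by apply: contraTneq ltuv => ->; rewrite ltxx.
  by rewrite (line_through2 (e := e0) nuv) -?le.
apply/imsetP; exists (u, v) => //; rewrite !inE /= luv ltuv lL eqxx andbT /=.
apply/forallP => w; apply/implyP => wl; apply/negP => /andP[uw wv].
by have := minv w; rewrite /P wl uw leNgt wv => /(_ isT).
Qed.

Lemma card_segments L : L \subset lines ->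
  (\sum_(l in L) #|l| <= #|segments L| + #|L|)%N.
Proof.
move=> sL.
apply: leq_trans (leq_sum _ (fun l lL => card_line_segments sL lL)) _.
rewrite big_split /= sum_nat_const muln1 leq_add2r.
rewrite -[leqRHS]sum1_card (partition_big line_through (mem L)) /= => [|e];
  last by rewrite inE => /and3P[].
apply: eq_leq; apply: eq_bigr => l _; rewrite -sum1dep_card.
by apply: eq_bigl => e; rewrite inE.
Qed.

(** The two lines determine the pair: they meet over a single abscissa, and on each line at most one
    segment has it in its interior. *)
Lemma card_crossing_segments L :
  (#|[set p in setX (segments L) (segments L) | cross X Y p.1 p.2]|
     <= #|L| ^ 2)%N.
Proof.
set K := [set p in _ | _]; pose phi (p : V * V * (V * V)) :=
  (line_through p.1, line_through p.2).
have dE := segments_drawing (L := L).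
have same e e' : e \in segments L -> e' \in segments L ->
    line_through e = line_through e' -> height X Y e =1 height X Y e'.
  rewrite inE => /and3P[lt _ _] _ ll.
  have ne : e.1 != e.2 by apply: contraTneq lt => ->; rewrite ltxx.
  by apply: (height_line ne); rewrite -?ll ?line_left ?line_right.
have injphi : {in K &, injective phi}.
  move=> [e f] [e' f'].
  rewrite [in X in X -> _]inE [in X in _ -> X -> _]inE !in_setX /=.
  move=> /andP[/andP[eE fE] /andP[nef /asboolP[x [xe xf hx]]]].
  move=> /andP[/andP[eE' fE'] /andP[nef' /asboolP[x' [xe' xf' hx']]]] [le lf].
  have he := same _ _ eE eE' le; have hf := same _ _ fE fE' lf.
  have xx : x = x'.
    apply/eqP/negPn/negP => nx; move/eqP: nef; apply.
    apply: (drawing_overlap injX dE eE fE xe xf) => z.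
    by apply: (eq_height _ nx hx); rewrite he hf.
  by rewrite -xx in xe' xf'; congr (_, _);
    apply: (drawing_overlap (x := x) injX dE).
rewrite -(card_in_imset injphi) -mulnn.
suff sub : phi @: K \subset setX L L by rewrite -cardsX subset_leq_card.
apply/subsetP => _ /imsetP[[e f] + ->]; rewrite !inE /=.
by move=> /andP[/andP[/and3P[_ -> _] /and3P[_ -> _]]].
Qed.

Lemma rich_lines_inequality L k q :
    L \subset lines -> {in L, forall l : {set V}, (k <= #|l|)%N} ->
  (#|L| * k.-1 * q.+1 ^ 2 <= 3 * #|V| * q.+1 ^ 3 + #|L| ^ 2)%N.
Proof.
move=> sL kL.
have h1 : (#|L| * k.-1 <= #|segments L|)%N.
  rewrite -(leq_add2r #|L|); apply: leq_trans (card_segments sL).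
  rewrite addnC -mulnS -sum_nat_const; apply: leq_sum => l lL.
  (* For [k = 0] the truncated [k.-1] is 0, and nonemptiness of the line is what remains. *)
  have := kL _ lL; case: k {kL} => //= _; rewrite card_gt0.
  have [e _ ->] := imsetP (subsetP sL _ lL).
  by apply/set0Pn; exists e.1; apply: line_left.
apply: (@leq_trans (#|segments L| * q.+1 ^ 2)); first by rewrite leq_mul2r h1 orbT.
apply: leq_trans (crossing_inequality q (segments_drawing (L := L))) _.
by rewrite leq_add2l card_crossing_segments.
Qed.
End RichLines.

(** * Collinear triples *)

(** If [M < 6 n], then [m k <= 12 n], and multiplying by [k ^ 2 <= D n] gives the term with [12 D].
    Otherwise a near-optimal [q] gives [m (k - 1)^3 <= 288 n^2], and [k <= 2 (k - 1)] costs a factor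
    8, whence 2304. *)
Lemma rich_arith m k n D : (1 < k)%N -> (k ^ 2 <= D * n)%N ->
    (forall q, m * k.-1 * q.+1 ^ 2 <= 3 * n * q.+1 ^ 3 + m ^ 2)%N ->
  (m * k ^ 3 <= (2304 + 12 * D) * n ^ 2)%N.
Proof.
move=> k1 kD mq; set M := (m * k.-1)%N in mq.
have k2 : (k <= 2 * k.-1)%N by lia.
have mk : (m * k <= 2 * M)%N by rewrite /M; nia.
case: (ltnP M (6 * n)) => [Mn|nM].
  have h : (m * k <= 12 * n)%N by lia.
  have := leq_mul h kD; rewrite -mulnA -expnS => /leq_trans; apply.
  by rewrite mulnDl -(leq_add2l 0) add0n; nia.
have [->|m0] := posnP m; first by [].
have [n0|n0] := posnP n.
  by move: kD; rewrite n0 muln0 leqn0 expn_eq0 andbT; lia.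
(* With [r.-1] for [q], the term [3 n r^3] is at most half of the left side. *)
pose r := (M %/ (6 * n))%N.
have r0 : (0 < r)%N by rewrite divn_gt0; lia.
have rM : (r * (6 * n) <= M)%N by apply: leq_divM.
have Mr : (M <= 12 * n * r)%N.
  have : (M < r.+1 * (6 * n))%N by apply: ltn_ceil; lia.
  nia.
have := mq r.-1; rewrite prednK // => hr.
have h1 : (M * r ^ 2 <= 2 * m ^ 2)%N.
  have : (2 * (3 * n * r ^ 3) <= M * r ^ 2)%N.
    rewrite (_ : 2 * _ = r * (6 * n) * r ^ 2)%N; last by ring.
    by rewrite leq_mul2r rM orbT.
  lia.
have h2 : (M ^ 3 <= 288 * n ^ 2 * m ^ 2)%N.
  rewrite expnS; apply: (@leq_trans (M * (12 * n * r) ^ 2)).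
    by rewrite leq_mul2l leq_exp2r // Mr orbT.
  rewrite (_ : M * _ = 144 * n ^ 2 * (M * r ^ 2))%N; last by ring.
  rewrite (_ : 288 * _ * _ = 144 * n ^ 2 * (2 * m ^ 2))%N; last by ring.
  by rewrite leq_mul2l h1 orbT.
have h3 : (m * k.-1 ^ 3 <= 288 * n ^ 2)%N.
  rewrite -(leq_pmul2r (_ : 0 < m ^ 2)%N) ?expn_gt0 ?m0 //.
  by apply: leq_trans h2; rewrite /M expnMn mulnAC -expnS.
apply: (@leq_trans (m * (2 * k.-1) ^ 3)).
  by rewrite leq_mul2l leq_exp2r ?k2 ?orbT.
apply: (@leq_trans (2304 * n ^ 2)); last by rewrite leq_mul2r leq_addr orbT.
rewrite (_ : m * _ = 8 * (m * k.-1 ^ 3))%N; last by rewrite expnMn; ring.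
by rewrite (_ : 2304 * _ = 8 * (288 * n ^ 2))%N ?leq_mul2l ?h3 //; ring.
Qed.

Section CollinearTriples.
Variables (R : realFieldType) (V : finType) (X Y : V -> R).
Hypothesis injX : injective X.
Variables (D l : nat).
Hypothesis lD : (l ^ 2 <= D * #|V|)%N.
Let lines := lines X Y.
Let line_through := line_through X Y.
Hypothesis line_le : {in lines, forall L : {set V}, (#|L| <= l)%N}.

Lemma line_card2 : {in lines, forall L : {set V}, (1 < #|L|)%N}.
Proof.
move=> L /imsetP[e]; rewrite inE => ne ->.
apply/card_gt1P; exists e.1, e.2; split=> //; first exact: line_left.
exact: line_right.
Qed.

(** A line with at least [2 ^ j] and fewer than [2 ^ j.+1] points is charged [8 * (2 ^ j) ^ 3] at
    level [j]. By [rich_arith] every level costs [O(n^2)], and since lines have two points the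
    levels start at 1. *)
Lemma sum_cubes_lines :
  (\sum_(L in lines) #|L| ^ 3
     <= 8 * (2304 + 12 * D) * trunc_log 2 l * #|V| ^ 2)%N.
Proof.
pose rich j := [set L in lines | (2 ^ j <= #|L|)%N].
have cube L : L \in lines ->
    (#|L| ^ 3 <=
       \sum_(1 <= j < (trunc_log 2 l).+1 | L \in rich j) 8 * (2 ^ j) ^ 3)%N.
  move=> Ll; have c2 := line_card2 Ll; set j := trunc_log 2 #|L|.
  have c0 : (0 < #|L|)%N by apply: ltn_trans c2.
  have jin : j \in index_iota 1 (trunc_log 2 l).+1.
    by rewrite mem_index_iota ltnS trunc_log_gt0 c2 leq_trunc_log ?line_le.
  rewrite (big_rem j) //= inE Ll trunc_logP //=.
  apply: leq_trans (leq_addr _ _).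
  rewrite (_ : 8 * _ = (2 ^ j.+1) ^ 3)%N;
    last by rewrite [(2 ^ j.+1)%N]expnS expnMn.
  by rewrite leq_exp2r // ltnW // trunc_log_ltn.
apply: leq_trans (leq_sum _ cube) _.
rewrite (exchange_big_dep xpredT) //=.
apply: (@leq_trans (\sum_(1 <= j < (trunc_log 2 l).+1)
                       8 * ((2304 + 12 * D) * #|V| ^ 2))); last first.
  by rewrite sum_nat_const_nat subSS subn0; apply: eq_leq; ring.
rewrite big_nat_cond [leqRHS]big_nat_cond.
apply: leq_sum => j /andP[/andP[j1 jl] _].
rewrite sum_nat_const mulnCA leq_mul2l /=.
have -> : #|[pred L in lines | L \in rich j]| = #|rich j|.
  by apply: eq_card => L; rewrite !inE andbA andbb.
apply: rich_arith => [||q]; first by rewrite (ltn_exp2l 0).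
  apply: leq_trans lD; rewrite leq_exp2r //.
  apply: leq_trans (leq_pexp2l _ (_ : j <= trunc_log 2 l)%N) _ => //.
  (* For [l = 0] there is no level [j >= 1], as [trunc_log 2 0 = 0]. *)
  apply: trunc_logP => //; move: jl; case: (l) => //.
  by rewrite trunc_log0; lia.
apply: (@rich_lines_inequality _ _ _ Y injX (rich j) (2 ^ j)%N) => [|L];
  last by rewrite inE => /andP[].
by apply/subsetP => L; rewrite inE => /andP[].
Qed.

Definition collinear_triples : {set V * V * V} :=
  [set p | [&& p.1.1 != p.1.2, p.1.2 != p.2, p.1.1 != p.2 &
               p.2 \in line_through p.1]].

Lemma card_collinear_triples :
  (#|collinear_triples| <= \sum_(L in lines) #|L| ^ 3)%N.
Proof.
rewrite -sum1_card.
rewrite (partition_big (fun p => line_through p.1) (mem lines)) /=; last first.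
  by move=> p; rewrite inE => /andP[ne _]; apply: imset_f; rewrite inE.
apply: leq_sum => L _; rewrite sum1dep_card.
rewrite -(_ : #|setX (setX L L) L| = #|L| ^ 3)%N;
  last by rewrite !cardsX -!mulnA.
apply/subset_leq_card/subsetP => -[[a b] c]; rewrite inE => /andP[+ /eqP <-].
rewrite inE /= => /and4P[ne _ _ cL]; rewrite !in_setX cL.
by rewrite (line_left X Y (a, b)) (@line_right _ _ _ _ injX (a, b)).
Qed.

Lemma card_triple : {in collinear_triples, forall p, #|triple p| = 3%N}.
Proof.
move=> p; rewrite inE => /and4P[n1 n2 n3 _].
by rewrite /triple !cardsU1 cards1 !inE negb_or n1 n2 n3.
Qed.

Lemma general_position_subset q : exists Q : {set V},
  {in Q & &, forall a b c, a != b -> b != c -> a != c ->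
     c \notin line_through (a, b)} /\
  (#|V| * q.+1 ^ 2 <= #|Q| * q.+1 ^ 3 +
     8 * (2304 + 12 * D) * trunc_log 2 l * #|V| ^ 2)%N.
Proof.
have [Q [iQ hQ]] := exists_independent q card_triple; exists Q; split.
  move=> a b c aQ bQ cQ ab bc ac; apply/negP => cl.
  have /iQ/negP[] : (a, b, c) \in collinear_triples by rewrite inE /= ab bc ac.
  by rewrite !subUset !sub1set aQ bQ.
apply: leq_trans hQ _; rewrite leq_add2l.
exact: leq_trans card_collinear_triples sum_cubes_lines.
Qed.
End CollinearTriples.

(** * Transfer to points of the plane *)

Lemma exists_shear (R : realFieldType) (V : finType) (f g : V -> R) :
    injective (fun v => (f v, g v)) ->
  exists t : R, injective (fun v => f v + t * g v).
Proof.
move=> injfg; pose h (p : V * V) := `|(f p.1 - f p.2) / (g p.1 - g p.2)|.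
(* A collision with [g u != g v] forces [t] to be minus a quotient whose absolute value is one of
   the [h p]; this [t] exceeds all of them. *)
exists (1 + \sum_p h p) => u v /= eq.
have gE : g u = g v.
  apply/eqP/negPn/negP => gN; have nz : g u - g v != 0 by rewrite subr_eq0.
  have tE : 1 + \sum_p h p = - ((f u - f v) / (g u - g v)).
    by apply: (mulIf nz); rewrite mulNr divfK // mulrBr; lra.
  have : h (u, v) <= \sum_p h p.
    rewrite (bigD1 (u, v)) //= lerDl.
    by apply: sumr_ge0 => p _; apply: normr_ge0.
  by rewrite /h /= -normrN -tE => /(le_trans (ler_norm _)); rewrite gerDr ler10.
by apply: injfg; rewrite gE in eq *; rewrite (addIr _ eq).
Qed.

Lemma card_fset_val (K : choiceType) (P : {fset K}) (Q : {set P}) :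
  #|` [fset val v | v in Q]%fset| = #|Q|.
Proof. by rewrite card_imfset ?cardE //; apply: val_inj. Qed.

Section PlanePoints.
Variables (R : realType) (P : {fset R * R}) (t : R).
Let X (v : P) : R := (val v).1 + t * (val v).2.
Let Y (v : P) : R := (val v).2.
Hypothesis injX : injective X.

Lemma line_through_le l : at_most_collinear l P ->
  {in lines X Y, forall L : {set P}, (#|L| <= l)%N}.
Proof.
move=> lP L /imsetP[e _ ->]; pose s := slope X Y e.
(* The graph of slope [s] in sheared coordinates, written in the original ones; if [s = 0], the
   second coefficient is 1. *)
apply: leq_trans (lP (- s) (1 - s * t) (Y e.1 - s * X e.1) _); last first.
  apply/negP => /eqP[/eqP]; rewrite oppr_eq0 => /eqP-> /eqP.
  by rewrite mul0r subr0 oner_eq0.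
rewrite -card_fset_val.
apply/fsubset_leq_card/fsubsetP => p /imfsetP[/= v ve ->].
rewrite !inE /= (valP v) /=; move: ve.
rewrite inE /height -/s => /eqP; rewrite /X /Y => hv.
by apply/eqP; lra.
Qed.

Lemma collinear3_line_through u v w : u != v ->
  collinear3 (val u) (val v) (val w) -> w \in line_through X Y (u, v).
Proof.
move=> nuv [a [b [d [nab []]]]]; rewrite !inE => /eqP hu /eqP hv /eqP hw.
have nX : X v - X u != 0 by rewrite subr_eq0 (inj_eq injX) eq_sym.
rewrite /height /slope /= eq_sym addrC -subr_eq -mulrAC; apply/eqP.
apply: (mulIf nX); rewrite divfK //; apply/eqP; rewrite -subr_eq0.
rewrite /X /Y; move: (val u) (val v) (val w) hu hv hw => p q r hp hq hr.
(* The shear terms cancel, so [z] is the determinant of [q - p] and [r - p]; both [a] and [b]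
   annihilate it. *)
set z := (X in X == 0).
have az : a * z = 0.
  have -> : a * z = (r.2 - p.2) * ((a * q.1 + b * q.2) - (a * p.1 + b * p.2))
      - (q.2 - p.2) * ((a * r.1 + b * r.2) - (a * p.1 + b * p.2)).
    by rewrite /z; ring.
  by rewrite hp hq hr subrr !mulr0 subrr.
have bz : b * z = 0.
  have -> : b * z = (q.1 - p.1) * ((a * r.1 + b * r.2) - (a * p.1 + b * p.2))
      - (r.1 - p.1) * ((a * q.1 + b * q.2) - (a * p.1 + b * p.2)).
    by rewrite /z; ring.
  by rewrite hp hq hr subrr !mulr0 subrr.
apply: contraNT nab => nz; apply/eqP; congr (_, _); apply: (mulIf nz);
  by rewrite mul0r.
Qed.

End PlanePoints.

(** * Choice of the sampling density *)

Section Asymptotics.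
Variable R : realType.

Lemma trunc_log2_le_ln l : (0 < l)%N -> (trunc_log 2 l)%:R <= 2 * ln (l%:R : R).
Proof.
move=> l0.
have ln2 : 2^-1 <= ln (2 : R).
  (* The bound [ln (1 + x) <= x] at [x = - 1/2] gives [ln 2 >= 1/2]. *)
  have := @le_ln1Dx R (- 2^-1).
  rewrite (_ : 1 + - 2^-1 = 2^-1) ?lnV ?posrE //; last by field.
  by lra.
have : ln ((2 ^ trunc_log 2 l)%:R : R) <= ln l%:R.
  by rewrite ler_ln ?posrE ?ltr0n ?expn_gt0 // ler_nat trunc_logP.
rewrite natrX lnXn // -(mulr_natr (ln 2) (trunc_log 2 l)) => h.
have := ler_wpM2r (ler0n R (trunc_log 2 l)) ln2; lra.
Qed.

(** Taking [q.+1] just above [y = sqrt (2 B J n)] makes the triple term at most half of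
    [n * q.+1 ^ 2], so [n <= 2 Q q.+1]. With [q.+1 <= 2 y], [y <= 2 b lam x] and [n = x^2 lam] this
    becomes [x <= 8 b Q]. Here [q] is fixed before [Q], as the selected set depends on [q]. *)
Lemma selection_bound (B J n l : nat) : (0 < n)%N -> (2 < l)%N -> (0 < B)%N ->
    (0 < J)%N -> J%:R <= 2 * ln (l%:R : R) ->
  exists q : nat, forall Q : nat,
    (n * q.+1 ^ 2 <= Q * q.+1 ^ 3 + B * J * n ^ 2)%N ->
  (8 * Num.sqrt B%:R)^-1 * Num.sqrt (n%:R / ln (l%:R : R)) <= Q%:R.
Proof.
move=> n0 l2 B0 J0 Jl; set lam := ln _ in Jl *.
have lam0 : 0 < lam by rewrite /lam ln_gt0 // ltr1n ltnW.
set x := Num.sqrt (_ / _).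
have x0 : 0 < x by rewrite sqrtr_gt0 divr_gt0 // ltr0n.
have nE : n%:R = x ^+ 2 * lam :> R.
  by rewrite sqr_sqrtr ?divfK ?gt_eqF // divr_ge0 // ltW.
set b := Num.sqrt _; have b0 : 0 < b by rewrite sqrtr_gt0 ltr0n.
have bE : B%:R = b ^+ 2 :> R by rewrite sqr_sqrtr.
pose y : R := Num.sqrt (2 * B * J * n)%:R.
have y1 : 1 <= y.
  by rewrite -[leLHS]sqrtr1 ler_sqrt ?ler0n // ler1n !muln_gt0 B0 J0 n0.
have yle : y <= 2 * b * lam * x.
  rewrite -(ler_pXn2r (n := 2)) ?nnegrE ?mulr_ge0
    ?(ltW b0, ltW x0, ltW lam0) //; last first.
    exact: le_trans y1.
  rewrite sqr_sqrtr ?ler0n // !natrM nE bE.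
  have -> : (2 * b * lam * x) ^+ 2 = 2 * b ^+ 2 * (2 * lam) * (x ^+ 2 * lam) by ring.
  by rewrite ler_pM2r ?ler_pM2l // ?mulr_gt0 ?exprn_gt0.
have := truncn_itv (le_trans ler01 y1); set q := Num.truncn y => /andP[qy yq].
exists q => Q hq.
have hs : (2 * B * J * n <= q.+1 ^ 2)%N.
  rewrite -(ler_nat R) natrX -(@sqr_sqrtr _ (2 * B * J * n)%:R) ?ler0n // -/y.
  by rewrite ler_pXn2r ?nnegrE ?sqrtr_ge0 ?ler0n // ltW.
have nQ : (n <= 2 * Q * q.+1)%N.
  rewrite -(leq_pmul2r (_ : 0 < q.+1 ^ 2)%N) // -mulnA -expnS.
  have := hq; have := leq_mul2r n (2 * B * J * n) (q.+1 ^ 2); rewrite hs orbT.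
  have -> : (2 * B * J * n * n = 2 * (B * J * n ^ 2))%N by ring.
  by move: (B * J * n ^ 2)%N (q.+1 ^ 3)%N (q.+1 ^ 2)%N => u v w; nia.
have sy : q.+1%:R <= 2 * y by rewrite -natr1; lra.
have : n%:R <= 2 * Q%:R * q.+1%:R :> R by rewrite -!natrM ler_nat.
have Q0 : 0 <= Q%:R :> R by [].
have : q.+1%:R <= 2 * (2 * b * lam * x) by apply: le_trans sy _; rewrite ler_pM2l.
move=> h1 h2; have := le_trans h2 (ler_wpM2l (mulr_ge0 (ler0n _ 2) Q0) h1).
rewrite nE ler_pdivrMl ?mulr_gt0 //.
have -> : 2 * Q%:R * (2 * (2 * b * lam * x)) = (8 * b * Q%:R) * (x * lam) by ring.
have -> : x ^+ 2 * lam = x * (x * lam) by ring.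
by rewrite ler_pM2r // mulr_gt0.
Qed.

End Asymptotics.

Theorem theorem3 (R : realType) (C : R) (hC : 0 < C) :
  exists2 c : R, 0 < c &
    forall (n l : nat) (P : {fset R * R}),
      (1 <= n)%N -> (3 <= l)%N -> l%:R <= C * Num.sqrt (n%:R : R) ->
      #|` P| = n -> at_most_collinear l P ->
      exists Q : {fset R * R},
        [/\ (Q `<=` P)%fset, general_position Q
          & c * Num.sqrt (n%:R / ln (l%:R : R)) <= #|` Q|%:R].
Proof.
(* [D] is a natural number above [C ^+ 2], so that [l ^ 2 <= D * n]; [B] is the constant in the
   bound on collinear triples. *)
pose D := Num.bound (C ^+ 2); pose B := (8 * (2304 + 12 * D))%N.
have CD : C ^+ 2 < D%:R by rewrite archi_boundP // sqr_ge0.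
exists (8 * Num.sqrt B%:R)^-1.
  by rewrite invr_gt0 mulr_gt0 // sqrtr_gt0 ltr0n.
move=> n l P n0 l3 lC cP lP.
have [t injX] : exists t, injective (fun v : P => (val v).1 + t * (val v).2).
  apply: exists_shear => u v [h1 h2]; apply/val_inj.
  by rewrite [LHS]surjective_pairing h1 h2 -surjective_pairing.
have cV : #|{: P}| = n by rewrite -cP cardfE.
have lD : (l ^ 2 <= D * #|{: P}|)%N.
  rewrite -(ler_nat R) natrX natrM cV.
  apply: (@le_trans _ _ ((C * Num.sqrt n%:R) ^+ 2)).
    by rewrite ler_pXn2r ?nnegrE ?mulr_ge0 ?sqrtr_ge0 ?(ltW hC).
  by rewrite exprMn sqr_sqrtr ?ler0n // ler_wpM2r // ltW.
have B0 : (0 < B)%N by rewrite muln_gt0 addn_gt0.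
have J0 : (0 < trunc_log 2 l)%N by rewrite trunc_log_gt0 (ltnW l3).
have Jl := trunc_log2_le_ln R (ltnW (ltnW l3)).
have [q hq] := selection_bound n0 l3 B0 J0 Jl.
have [Q [gQ cQ]] := general_position_subset injX lD (line_through_le lP) q.
exists [fset val v | v in Q]%fset; split.
- by apply/fsubsetP => p /imfsetP[v _ ->]; apply: valP.
- move=> _ _ _ /imfsetP[u uQ ->] /imfsetP[v vQ ->] /imfsetP[w wQ ->].
  rewrite !(inj_eq val_inj) => uv vw uw col.
  by have /negP[] := gQ _ _ _ uQ vQ wQ uv vw uw; apply: collinear3_line_through.
rewrite card_fset_val; apply: hq; rewrite -cV; exact: cQ.
Qed.
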